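(* Let $q\in\mathbb{N}$ with $q\ge 3$ and let $\mathcal{A}\subseteq\{0,1,\ldots,q-1\}$ with $1<\#\mathcal{A}<q$. Let $r=s/t\in(0,1)\cap\mathbb{Q}$ with $s,t\in\mathbb{N}$, $\gcd(s,t)=1$. If $t$ has a prime factor that does not divide $q$, then for every positive rational $\alpha$, the set $\{k\in\mathbb{N}: \alpha r^k\in K(q,\mathcal{A})\}$ is finite.
   Context: $K(q,\mathcal{A}):=\{\sum_{i=1}^\infty d_i q^{-i}: d_i\in\mathcal{A}\ \forall i\in\mathbb{N}\}$. *)

(* Defs.v *)
From HB Require Import structures.
From mathcomp Require Import all_boot all_order all_algebra.
From mathcomp Require Import all_classical all_reals all_analysis.

Set Implicit Arguments.
Unset Strict Implicit.
Unset Printing Implicit Defensive.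

Import Order.TTheory GRing.Theory Num.Theory.
Import numFieldNormedType.Exports.

Local Open Scope classical_set_scope.
Local Open Scope ring_scope.

(* Digits are indexed from 0, so [d i] is the coefficient of q^-(i+1). *)
Definition K (R : realType) (q : nat) (A : {set 'I_q}) : set R :=
  [set x | exists d : nat -> 'I_q,
     (forall i, d i \in A) /\
     series (fun i => (d i : nat)%:R / q%:R ^+ i.+1 : R) @ \oo --> x].

(* Main.v *)
Require Import Defs.
From HB Require Import structures.
From mathcomp Require Import all_boot all_order all_algebra all_solvable.
From mathcomp Require Import all_classical all_reals all_analysis.
From mathcomp Require Import zify ring lra.

(** Multiplication by [q] modulo 1 maps [K A] to itself, and [K A] avoids the
    open interval [(u / q, (u + 1) / q)] for every missing digit [u]; so it is
    enough to show that the orbit of [alpha * r ^ k] under multiplication by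
    [q] enters this gap once [k] is large.  Some multiple
    [q ^ L * alpha * r ^ k] has the form [N / (p ^ m * w ^ (k + 1))] where [w]
    is prime to [p q], [m >= k], and the valuation of [N] at [p] does not
    depend on [k].  A fixed power [P] of [q] is congruent to 1 modulo [p ^ 2 w].
    Then [P ^ (w ^ k)] is congruent to 1 modulo [w ^ (k + 1)], while
    [P ^ (w ^ k) - 1] has the same valuation [c] at [p] as [P - 1], since [w]
    is prime to [p].  The powers of [P ^ (w ^ k)] thus cover all residues
    congruent to 1 modulo [p ^ c * w ^ (k + 1)], and the orbit contains all
    translates of a point by multiples of [p ^ (c' - m)] modulo 1, with [c']
    independent of [k]: it is eventually finer than the gap. *)

Set Implicit Arguments.
Unset Strict Implicit.
Unset Printing Implicit Defensive.

Import Order.TTheory GRing.Theory Num.Theory.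
Import numFieldNormedType.Exports.

(** * Arithmetic: powers of [q] modulo [p ^ m * w ^ k.+1] *)

Lemma expn1D_second_order (x n : nat) : exists e, (1 + x) ^ n = 1 + n * x + x ^ 2 * e.
Proof.
elim: n => [|n [e IH]]; first by exists 0; rewrite expn0 mul0n muln0.
by exists (n + e + x * e); rewrite expnS IH; ring.
Qed.

(** Strip off [p], or else a nontrivial [gcdn q n], until the rest is prime to both. The factor [d]
    is the part of a denominator that a power of [q] cancels. *)
Lemma split_coprime_part (p q n : nat) : prime p -> ~~ (p %| q) -> 0 < n ->
  exists v w d l, [/\ n = p ^ v * w * d, coprime p w, coprime q w & d %| q ^ l].
Proof.
move=> pp pq; elim/ltn_ind: n => n IH n0.
case pn: (p %| n).
  case/dvdnP: pn => n' nE.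
  have n'0 : 0 < n' by move: n0; rewrite nE muln_gt0 => /andP[].
  have [|v [w [d [l [E cpw cqw dl]]]]] := IH n' _ n'0.
    by rewrite nE ltn_Pmulr ?prime_gt1.
  exists v.+1, w, d, l; split=> //.
  by rewrite nE E expnS; ring.
case g1: (coprime q n).
  exists 0, n, 1, 0; split=> //; first by rewrite mul1n muln1.
  by rewrite prime_coprime // pn.
have g_gt0 : 0 < gcdn q n by rewrite gcdn_gt0 n0 orbT.
have g_gt1 : 1 < gcdn q n by move: g1 g_gt0; rewrite /coprime; case: gcdn => [|[]].
have /dvdnP[n' nE] := dvdn_gcdr q n.
have n'0 : 0 < n' by move: n0; rewrite nE muln_gt0 => /andP[].
have [|v [w [d [l [E cpw cqw dl]]]]] := IH n' _ n'0.
  by rewrite [ltnRHS]nE ltn_Pmulr.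
exists v, w, (d * gcdn q n), l.+1; split=> //.
  by rewrite [LHS]nE E mulnA.
by rewrite expnSr dvdn_mul // dvdn_gcdl.
Qed.

Lemma pfactor_unit_expn (p c g n : nat) : prime p -> 0 < c -> ~~ (p %| g) ->
  ~~ (p %| n) -> exists2 h, (1 + p ^ c * g) ^ n = 1 + p ^ c * h & ~~ (p %| h).
Proof.
move=> pp c0 pg pn; have [e ->] := expn1D_second_order (p ^ c * g) n.
exists (n * g + p ^ c * (g ^ 2 * e)); first by ring.
rewrite dvdn_addl; first by rewrite Euclid_dvdM // negb_or pn.
by rewrite dvdn_mulr // dvdn_exp.
Qed.

(* The hypothesis [1 < c] makes this valid for [p = 2] as well. *)
Lemma pfactor_unit_lift (p c g i : nat) : prime p -> 1 < c -> ~~ (p %| g) ->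
  exists2 h, (1 + p ^ c * g) ^ (p ^ i) = 1 + p ^ (c + i) * h & ~~ (p %| h).
Proof.
move=> pp c1 pg; elim: i => [|i [h E ph]].
  by exists g; rewrite ?addn0 ?expn0 ?expn1.
have [e He] := expn1D_second_order (p ^ (c + i) * h) p.
(* Since [c + i >= 2], the quadratic term keeps a factor [p] after division by [p ^ (c + i).+1]. *)
have [C CE] : exists C, c + i = C.+2.
  by exists (c + i - 2); rewrite -[RHS]addn2 subnK // (leq_trans c1) ?leq_addr.
exists (h + p * (p ^ C * h ^ 2 * e)).
  rewrite expnSr expnM E He addnS CE !(expnS p).
  by move: (p ^ C) => X; ring.
by rewrite dvdn_addl // dvdn_mulr.
Qed.

Lemma modn_solve (H a n b y : nat) : 0 < H -> 0 < n -> coprime a n ->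
  b = y %[mod H] -> exists i, b + H * (a * i) = y %[mod H * n].
Proof.
move=> H0 n0 can /eqP bE.
(* Adding a multiple of [H * n] to [y] keeps the subtraction of [b] from truncating. *)
have bY : b <= y + H * n * b.
  by rewrite (leq_trans _ (leq_addl _ _)) // leq_pmull // muln_gt0 H0.
have /dvdnP[e eE] : H %| y + H * n * b - b.
  by rewrite -eqn_mod_dvd // -mulnA addnC mulnC modnMDl eq_sym.
(* By Euler, [a ^ (totient n).-1] inverts [a] modulo [n]. *)
exists (a ^ (totient n).-1 * e).
have -> : a * (a ^ (totient n).-1 * e) = a ^ totient n * e.
  by rewrite mulnA -expnS prednK // totient_gt0.
have En : a ^ totient n * e = e %[mod n].
  by rewrite -modnMml Euler_exp_totient // modnMml mul1n.
have -> : y %% (H * n) = (b + H * e) %% (H * n).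
  by rewrite [H * e]mulnC -eE subnKC // [in RHS]addnC [H * n * b]mulnC modnMDl.
by apply/eqP; rewrite eqn_modDl -!muln_modr En.
Qed.

(** Successive approximation: adding [p ^ m * i] to the exponent adds
    [p ^ (c + m) * (Q ^ n * h * i)] modulo [p ^ (c + m).+1], and [Q ^ n * h] is invertible modulo
    [p]. *)
Lemma pfactor_unit_generates (p c g m z : nat) : prime p -> 1 < c -> ~~ (p %| g) ->
  exists n, (1 + p ^ c * g) ^ n = 1 + p ^ c * z %[mod p ^ (c + m)].
Proof.
move=> pp c1 pg; have p0 := prime_gt0 pp; elim: m => [|m [n IH]].
  by exists 0; rewrite addn0 expn0 mulnC addnC modnMDl.
have [h E ph] := pfactor_unit_lift m pp c1 pg.
set Q := 1 + p ^ c * g in IH E *.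
have cpQ : coprime (Q ^ n * h) p.
  rewrite coprime_sym coprimeMr [coprime p h]prime_coprime // ph andbT.
  rewrite coprimeXr // prime_coprime //.
  rewrite dvdn_addl ?dvdn_mulr ?dvdn_exp ?(ltnW c1) //.
  by rewrite dvdn1 neq_ltn prime_gt1 ?orbT.
have pcm0 : 0 < p ^ (c + m) by rewrite expn_gt0 p0.
have [i iE] := modn_solve pcm0 p0 cpQ IH.
exists (n + p ^ m * i); rewrite addnS expnSr -iE expnD expnM E.
have [e ->] := expn1D_second_order (p ^ (c + m) * h) i.
have [C CE] : exists C, c + m = C.+1.
  by exists (c + m).-1; rewrite prednK // addn_gt0 ltnW.
have -> : Q ^ n * (1 + i * (p ^ (c + m) * h) + (p ^ (c + m) * h) ^ 2 * e) =
   (Q ^ n * h ^ 2 * e * p ^ C) * (p ^ (c + m) * p)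
   + (Q ^ n + p ^ (c + m) * (Q ^ n * h * i)).
  by rewrite CE expnS; ring.
by rewrite modnMDl.
Qed.

Lemma expn_mod1_lift (w z k : nat) :
  exists h, (1 + w * z) ^ (w ^ k) = 1 + w ^ k.+1 * h.
Proof.
elim: k => [|k [h IH]]; first by exists z; rewrite expn0 !expn1.
have [e E] := expn1D_second_order (w ^ k.+1 * h) w.
exists (h + w ^ k * h ^ 2 * e).
by rewrite expnSr expnM IH E !expnS; ring.
Qed.

Lemma powers_cover_class (p q w : nat) : prime p -> ~~ (p %| q) -> 1 < q ->
  coprime p w -> coprime q w ->
  exists c, forall k m j,
    exists n, q ^ n = 1 + p ^ c * w ^ k.+1 * j %[mod p ^ m * w ^ k.+1].
Proof.
move=> pp pq q1 cpw cqw.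
have w0 : 0 < w.
  by case: w cqw {cpw} => //; rewrite /coprime gcdn0; case: q q1 {pq} => [|[]].
(* The square of [p] ensures [c > 1] below. *)
have p2w0 : 0 < p ^ 2 * w by rewrite muln_gt0 expn_gt0 prime_gt0.
have cq : coprime q (p ^ 2 * w).
  by rewrite coprimeMr cqw andbT coprimeXr // coprime_sym prime_coprime.
have T0 : 0 < totient (p ^ 2 * w) by rewrite totient_gt0.
have P1 : 1 < q ^ totient (p ^ 2 * w).
  by rewrite (leq_trans q1) // -{1}(expn1 q) leq_pexp2l // ltnW.
set P := q ^ totient (p ^ 2 * w) in P1.
have Pdvd : p ^ 2 * w %| P - 1.
  by rewrite -eqn_mod_dvd ?(ltnW P1) //; apply/eqP/Euler_exp_totient.
have P10 : 0 < P - 1 by rewrite subn_gt0.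
have [g cpg gE] := pfactor_coprime pp P10.
set c := logn p (P - 1) in gE.
have c1 : 1 < c by rewrite -pfactor_dvdn // (dvdn_trans _ Pdvd) // dvdn_mulr.
have PE : P = 1 + p ^ c * g by rewrite [p ^ c * g]mulnC -gE subnKC // ltnW.
have /dvdnP[z zE] : w %| P - 1 by rewrite (dvdn_trans _ Pdvd) // dvdn_mull.
have PE' : P = 1 + w * z by rewrite [w * z]mulnC -zE subnKC // ltnW.
exists c => k m j.
have pg : ~~ (p %| g) by rewrite -prime_coprime.
have pwk : ~~ (p %| w ^ k) by rewrite -prime_coprime // coprimeXr.
have [h hE ph] := pfactor_unit_expn pp (ltnW c1) pg pwk.
have [h' hE'] := expn_mod1_lift w z k.
have [n nE] := pfactor_unit_generates m (w ^ k.+1 * j) pp c1 ph.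
(* The factor [w ^ k] gives the residue 1 modulo [w ^ k.+1], and [n] adjusts the residue modulo
   [p ^ m]; the Chinese remainder theorem joins the two. *)
exists (totient (p ^ 2 * w) * w ^ k * n); rewrite expnM expnM -/P.
apply/eqP; rewrite chinese_remainder ?coprimeXl ?coprimeXr //; apply/andP; split.
  rewrite {1}PE hE -mulnA.
  have dm : p ^ m %| p ^ (c + m) by rewrite dvdn_exp2l // leq_addl.
  by rewrite -(modn_dvdm _ dm) nE modn_dvdm.
have -> : 1 + p ^ c * w ^ k.+1 * j = p ^ c * j * w ^ k.+1 + 1 by ring.
rewrite PE' hE' modnMDl.
have [e ->] := expn1D_second_order (w ^ k.+1 * h') n.
apply/eqP; have -> : 1 + n * (w ^ k.+1 * h') + (w ^ k.+1 * h') ^ 2 * e =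
  (n * h' + w ^ k.+1 * h' ^ 2 * e) * w ^ k.+1 + 1 by ring.
by rewrite modnMDl.
Qed.

(* The residues reached are all those congruent to [p ^ f * N] modulo
   [H = p ^ (c + f) * w ^ k.+1], and [H / D <= 1 / (2 q)]. *)
Lemma orbit_hits_gap (p q w : nat) : prime p -> ~~ (p %| q) -> 1 < q ->
  coprime p w -> coprime q w ->
  exists c, forall k m f N u, let D := p ^ m * w ^ k.+1 in
    ~~ (p %| N) -> c + f + 2 * q <= m ->
    exists n y, q ^ n * (p ^ f * N) = y %[mod D] /\ u * D < q * y < u.+1 * D.
Proof.
move=> pp pq q1 cpw cqw; have p1 := prime_gt1 pp.
have w0 : 0 < w.
  by case: w cqw {cpw} => //; rewrite /coprime gcdn0; case: q q1 {pq} => [|[]].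
have [c cP] := powers_cover_class pp pq q1 cpw cqw.
exists c => k m f N u D pN lem.
have [M mE] : exists M, m = c + f + M.
  by exists (m - (c + f)); rewrite subnKC // (leq_trans _ lem) ?leq_addr.
have leM : 2 * q <= p ^ M.
  by rewrite (leq_trans _ (ltnW (ltn_expl M p1))) // -(leq_add2l (c + f)) -mE.
pose H := p ^ (c + f) * w ^ k.+1.
have DE : D = H * p ^ M by rewrite /D /H mE expnD; ring.
have H0 : 0 < H by rewrite muln_gt0 !expn_gt0 w0 prime_gt0.
(* [X.+1] is the first multiple of [q * H] beyond [u * D]; the remainder adds less than another
   [q * H], and [2 * q * H <= D]. *)
pose X := u * D %/ (q * H); pose y := (p ^ f * N) %% H + H * X.+1.
have yE : p ^ f * N = y %[mod H].
  by rewrite /y addnC [H * _]mulnC modnMDl modn_mod.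
have cN : coprime N (p ^ M) by rewrite coprimeXr // coprime_sym prime_coprime.
have [|i iE] := modn_solve H0 _ cN yE; first by rewrite expn_gt0 prime_gt0.
have [n nE] := cP k m i.
exists n, y; split.
  rewrite -modnMml nE modnMml -/D DE -iE; congr (_ %% _).
  by rewrite /H expnD; ring.
have qH0 : 0 < q * H by rewrite muln_gt0 (ltnW q1).
have lt1 : u * D < X * (q * H) + q * H by rewrite -mulSnr -ltn_divLR.
have le2 : X * (q * H) <= u * D by rewrite leq_divM.
have lt3 : q * ((p ^ f * N) %% H) < q * H by rewrite ltn_pmul2l ?ltn_mod // ltnW.
have le4 : q * H + q * H <= D.
  by rewrite addnn -mul2n mulnA DE mulnC leq_mul2l leM orbT.
have -> : q * y = X * (q * H) + q * H + q * ((p ^ f * N) %% H) by rewrite /y; ring.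
rewrite mulSnr -addnA (leq_trans lt1) ?addnA ?leq_addr //=.
by rewrite -addnA -addnS leq_add // (leq_trans _ le4) // -addnS leq_add2l.
Qed.

(** * Dynamics of multiplication by [q] on [K A] *)

Local Open Scope classical_set_scope.
Local Open Scope ring_scope.

Lemma K_bounds (R : realType) (q : nat) (A : {set 'I_q}) (x : R) :
  K A x -> 0 <= x <= 1.
Proof.
move=> [d [_ dx]].
have q0 : (0 < q)%N by case: q A d {dx} => // A d; case: (d 0%N).
have qR : 0 < q%:R :> R by rewrite ltr0n.
(* Digits are at most [q - 1], so each term is bounded by a telescoping difference. *)
have S01 n : 0 <= series (fun i => (d i : nat)%:R / q%:R ^+ i.+1 : R) n
    <= 1 - (q%:R ^+ n)^-1.
  elim: n => [|n /andP[IH0 IH1]].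
    by rewrite /series /= big_geq // expr0 invr1 subrr lexx.
  rewrite seriesEnat /= big_nat_recr //=; rewrite seriesEnat /= in IH0 IH1.
  have h0 : 0 <= (d n : nat)%:R / q%:R ^+ n.+1 :> R.
    by rewrite divr_ge0 // exprn_ge0.
  have h1 : (d n : nat)%:R / q%:R ^+ n.+1 <= (q%:R ^+ n)^-1 - (q%:R ^+ n.+1)^-1 :> R.
    have -> : (q%:R ^+ n)^-1 = q%:R / q%:R ^+ n.+1 :> R.
      by rewrite exprS invfM mulrA divff ?mul1r ?gt_eqF.
    rewrite -[X in _ - X]mul1r -mulrBl ler_pM2r ?invr_gt0 ?exprn_gt0 //.
    by rewrite lerBrDr natr1 ler_nat.
  by apply/andP; split; lra.
apply/andP; split.
  rewrite -(cvg_lim _ dx) //; apply: limr_ge; first by apply/cvg_ex; exists x.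
  by apply: nearW => n; have /andP[] := S01 n.
rewrite -(cvg_lim _ dx) //; apply: limr_le; first by apply/cvg_ex; exists x.
apply: nearW => n; have /andP[_ /le_trans] := S01 n; apply.
by rewrite gerBl invr_ge0 exprn_ge0.
Qed.

Lemma K_mulq (R : realType) (q : nat) (A : {set 'I_q}) (x : R) :
  K A x -> exists d y, [/\ d \in A, K A y & q%:R * x = (d : nat)%:R + y].
Proof.
move=> [d [dA dx]].
have q0 : (0 < q)%N by case: q A d {dA dx} => // A d; case: (d 0%N).
have qR : q%:R != 0 :> R by rewrite pnatr_eq0 -lt0n.
exists (d 0%N), (q%:R * x - (d 0%N : nat)%:R); split=> //; last by rewrite addrC subrK.
exists (fun i => d i.+1); split=> //.
have -> : series (fun i => (d i.+1 : nat)%:R / q%:R ^+ i.+1 : R) =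
   (fun n => q%:R * series (fun i => (d i : nat)%:R / q%:R ^+ i.+1 : R) n.+1
             - (d 0%N : nat)%:R).
  apply/funext => n; rewrite !seriesEnat /= big_nat_recl //= expr1 mulrDr.
  rewrite mulrCA divff // mulr1 [X in _ = X - _]addrC addrK mulr_sumr.
  apply: eq_bigr => i _; rewrite mulrCA; congr (_ * _).
  by rewrite [in RHS]exprS invfM mulrA divff // mul1r.
apply: cvgB; last exact: cvg_cst.
apply: cvgM; first exact: cvg_cst.
by rewrite cvg_shiftS.
Qed.

Lemma K_orbit (R : realType) (q : nat) (A : {set 'I_q}) (x : R) (n : nat) :
  K A x -> exists (z : nat) y, K A y /\ q%:R ^+ n * x = z%:R + y.
Proof.
move=> Kx; elim: n => [|n [z [y [Ky E]]]].
  by exists 0%N, x; rewrite expr0 mul1r add0r.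
have [d [y' [_ Ky' E']]] := K_mulq Ky.
exists (q * z + d)%N, y'; split=> //.
by rewrite exprS -mulrA E mulrDr E' natrD natrM addrA.
Qed.

(** The bounds on tails of expansions include 0 and 1, where integer parts are ambiguous. The strict
    inequalities exclude these cases: they give [0 < y < D], which fixes the integer part, and then
    force the next digit to be [u]. *)
Lemma K_orbit_avoids_gap (R : realType) (q : nat) (A : {set 'I_q}) (x : R)
    (u : 'I_q) (n D y z : nat) :
  K A x -> u \notin A -> (0 < D)%N -> q%:R ^+ n * x * D%:R = (z * D + y)%:R ->
  ~~ (u * D < q * y < u.+1 * D)%N.
Proof.
move=> Kx uA D0 E; apply/negP => /andP[lo hi].
have q0 : (0 < q)%N by apply: leq_ltn_trans (ltn_ord u).
have [z' [y' [Ky' E']]] := K_orbit n Kx.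
have [d [y'' [dA Ky'' E'']]] := K_mulq Ky'.
have /andP[y'0 y'1] := K_bounds Ky'.
have /andP[y''0 y''1] := K_bounds Ky''.
have DR : 0 < D%:R :> R by rewrite ltr0n.
have y0 : (0 < y)%N by nia.
have yD : (y < D)%N by have := ltn_ord u; nia.
have {E} E : (z'%:R + y') * D%:R = z%:R * D%:R + y%:R by rewrite -E' E natrD natrM.
have y0R : 0 < y%:R :> R by rewrite ltr0n.
have yDR : y%:R < D%:R :> R by rewrite ltr_nat.
have zE : z' = z.
  have lt1 : (z' < z.+1)%N.
    by rewrite -(ltr_nat R) -(ltr_pM2r DR) -natr1; nra.
  have lt2 : (z < z'.+1)%N.
    by rewrite -(ltr_nat R) -(ltr_pM2r DR) -natr1; nra.
  by apply/eqP; rewrite eqn_leq -ltnS lt1 -ltnS lt2.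
have yE : y' * D%:R = y%:R.
  by move: E; rewrite zE mulrDl => /addrI.
have qyE : ((d : nat)%:R + y'') * D%:R = q%:R * y%:R :> R.
  by rewrite -E'' -mulrA yE.
have du : (d : nat) != u by apply: contraNneq uA => /val_inj <-.
move: lo hi; rewrite -!(ltr_nat R) !natrM -qyE !ltr_pM2r // => lo hi.
have lt1 : (u < d.+1)%N by rewrite -(ltr_nat R) -natr1; lra.
have lt2 : (d < u.+1)%N by rewrite -(ltr_nat R); lra.
by move: du; rewrite eqn_leq -ltnS lt2 -ltnS lt1.
Qed.

(** * Clearing denominators and conclusion *)

Theorem theorem1p5 (R : realType) (q : nat) (A : {set 'I_q})
    (r : rat) (s t : nat)
    (hq : (3 <= q)%N) (hA : (1 < #|A| < q)%N)
    (hr : 0 < r < 1) (hrst : r = s%:R / t%:R) (hst : coprime s t)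
    (ht : exists p : nat, [/\ prime p, (p %| t)%N & ~~ (p %| q)%N]) :
  forall alpha : rat, 0 < alpha ->
    finite_set [set k : nat | K A (ratr (alpha * r ^+ k) : R)].
Proof.
move=> alpha alpha0; case: ht => p [pp pt pq].
have /andP[r0 _] := hr; have q1 : (1 < q)%N by exact: ltnW.
have t0 : (0 < t)%N by case: t hrst {hst pt} r0 => // ->; rewrite invr0 mulr0 ltxx.
have ps : ~~ (p %| s)%N.
  rewrite -prime_coprime //; apply: coprime_dvdl pt _.
  by rewrite coprime_sym.
have [u uA] : exists u, u \notin A.
  apply/existsP; rewrite -negb_forall; apply/negP => /forallP allA.
  have /andP[_] := hA; have -> : A = finset.setT by apply/setP => i; rewrite inE allA.
  by rewrite cardsT card_ord ltnn.
have [a [b [a0 b0 abE]]] : exists a b : nat,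
    [/\ (0 < a)%N, (0 < b)%N & alpha * b%:R = a%:R].
  exists `|numq alpha|%N, `|denq alpha|%N; rewrite !absz_gt0 numq_eq0 denq_eq0.
  rewrite gt_eqF //; split=> //.
  rewrite !pmulrn !gez0_abs ?denq_ge0 ?numq_ge0 ?(ltW alpha0) //.
  by rewrite -[X in X * _]divq_num_den mulfVK // intr_eq0 denq_eq0.
have [a' cpa' aE] := pfactor_coprime pp a0; set f := logn p a in aE.
have [bv [bw [bd [bl [bE cpbw cqbw bdl]]]]] := split_coprime_part pp pq b0.
have [tv [tw [td [tl [tE cptw cqtw tdl]]]]] := split_coprime_part pp pq t0.
(* This makes the exponent [bv + tv * k] of [p] in the denominator at least [k]. *)
have tv0 : (0 < tv)%N.
  rewrite lt0n; apply/eqP => tv0.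
  move: pt; rewrite tE tv0 mul1n Euclid_dvdM // => /orP[pw|pd].
    by move: cptw; rewrite prime_coprime // pw.
  have := dvdn_trans pd tdl.
  by rewrite Euclid_dvdX // (negPf pq).
have cpw : coprime p (bw * tw) by rewrite coprimeMr cpbw.
have cqw : coprime q (bw * tw) by rewrite coprimeMr cqbw.
have [c cP] := orbit_hits_gap pp pq q1 cpw cqw.
apply: (sub_finite_set (B := `I_(c + f + 2 * q))); last exact: finite_II.
move=> k /= Kk; rewrite ltnNge; apply/negP => lek.
have dL : (bd * td ^ k %| q ^ (bl + tl * k))%N.
  by rewrite expnD expnM dvdn_mul // dvdn_exp2r.
have /dvdnP[e eE] := dL.
have pe : ~~ (p %| e)%N.
  apply: contra pq => pe; have := dvdn_mulr (bd * td ^ k) pe.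
  by rewrite -eE Euclid_dvdX // => /andP[].
(* The factor [bw ^ k * tw] completes the part [bw * tw ^ k] of the denominator to
   [(bw * tw) ^ k.+1], and [e] is what remains of the power of [q] after cancelling
   [bd * td ^ k]. *)
pose N := (a' * s ^ k * e * bw ^ k * tw)%N.
have pN : ~~ (p %| N)%N.
  rewrite -prime_coprime // /N !coprimeMr cpa' cptw !coprimeXr //=.
  - by rewrite prime_coprime // pe.
  - by rewrite prime_coprime.
have lem : (c + f + 2 * q <= bv + tv * k)%N.
  by rewrite (leq_trans lek) // (leq_trans _ (leq_addl _ _)) // leq_pmull.
have [n [y [yE gap]]] := cP k (bv + tv * k)%N f N u pN lem.
set D := (p ^ _ * _ ^ _)%N in yE gap.
have D0 : (0 < D)%N by case: (D) gap => //; rewrite !muln0 ltn0 andbF.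
have yD : (y < D)%N.
  have /andP[_ lt] := gap; rewrite -(ltn_pmul2l (ltnW q1)) (leq_trans lt) //.
  by rewrite leq_mul2r ltn_ord orbT.
pose z := ((q ^ n * (p ^ f * N)) %/ D)%N.
suff E : q%:R ^+ (n + (bl + tl * k)) * ratr (alpha * r ^+ k) * D%:R
    = (z * D + y)%:R :> R.
  by have := K_orbit_avoids_gap Kk uA D0 E; rewrite gap.
have -> : (z * D + y = q ^ n * (p ^ f * N))%N.
  by rewrite [RHS](divn_eq _ D) yE modn_small.
rewrite -natrX -[(q ^ _)%:R](ratr_nat R) -[D%:R](ratr_nat R) -[RHS](ratr_nat R).
rewrite -!rmorphM /=; congr ratr.
have rE : alpha * r ^+ k * (b * t ^ k)%:R = (a * s ^ k)%:R.
  rewrite !natrM !natrX hrst expr_div_n mulrACA abE divfK //.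
  by rewrite expf_neq0 // pnatr_eq0 -lt0n.
have DE : (q ^ (bl + tl * k) * D = b * t ^ k * (e * bw ^ k * tw))%N.
  rewrite eE /D bE tE !expnMn !expnD -expnM !expnS; ring.
have NE : (p ^ f * N = a * s ^ k * (e * bw ^ k * tw))%N.
  by rewrite aE /N; ring.
rewrite mulrAC -natrM expnD -mulnA DE NE !(natrM _ (q ^ n)) -[LHS]mulrA; congr (_ * _).
by rewrite natrM mulrAC [X in X * _]mulrC rE -natrM.
Qed.
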